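(* Let $G$ be a transitive groupoid endowed with a second countable locally compact Hausdorff topology $\tau$ making $G$ a topological groupoid. Then there is a topology $\tilde{\tau}$ on $G$ such that: 1. $G$ is a (topological) locally transitive groupoid with respect to $\tilde{\tau}$ (hence $G$ has open range map with respect to $\tilde{\tau}$). 2. $\tilde{\tau}$ is finer than $\tau$ (not necessarily strictly, i.e. $\tau\subset\tilde{\tau}$); moreover $\tau=\tilde{\tau}$ if $(G,\tau)$ is locally transitive. 3. For every $u\in G^{(0)}$, the topologies induced by $\tau$ and $\tilde{\tau}$ on the $r$-fibre $G^u$ coincide, and the topologies induced by $\tau$ and $\tilde{\tau}$ on the $d$-fibre $G_u$ coincide. 4. $\tilde{\tau}$ is second countable and locally compact Hausdorff. 5. $\tau$ and $\tilde{\tau}$ generate the same Borel structure on $G$, i.e. the $\sigma$-algebra generated by the $\tau$-open sets equals the $\sigma$-algebra generated by the $\tilde{\tau}$-open sets.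
   Context: For a groupoid $G$, $G^{(2)}$ denotes the set of composable pairs, $G^{(0)}\subset G$ the unit space, $r(x)=xx^{-1}$ the range and $d(x)=x^{-1}x$ the domain of $x\in G$. For $u\in G^{(0)}$, $G^u=r^{-1}(\{u\})$ and $G_u=d^{-1}(\{u\})$ are the $r$-fibre and $d$-fibre over $u$. $G$ is transitive if for all $u,v\in G^{(0)}$ there is $x\in G$ with $r(x)=u$ and $d(x)=v$. A topological groupoid is a groupoid $G$ with a topology such that inversion $G\to G$ is continuous and the product map $G^{(2)}\to G$ is continuous, where $G^{(2)}$ has the topology induced from $G\times G$; $G^{(0)}$ carries the subspace topology. A topological groupoid is locally transitive if for every $u\in G^{(0)}$ the map $r_u:G_u\to G^{(0)}$, $r_u(x)=r(x)$, is open, where $G_u$ is endowed with the topology induced from $G$. *)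

(* Defs.v *)
From HB Require Import structures.
From mathcomp Require Import all_boot.
From mathcomp Require Import all_classical.
From mathcomp Require Import topology measure.

Set Implicit Arguments.
Unset Strict Implicit.
Unset Printing Implicit Defensive.

Local Open Scope classical_set_scope.

(* The product is a partial map; it is represented by a total function [gmul], *)
(* about whose values outside of [composable] (that is, G^(2)) nothing is      *)
(* assumed.                                                                    *)
Record groupoid (G : Type) := Groupoid {
  composable : set (G * G);
  gmul : G -> G -> G;
  ginv : G -> G;
  composable_mull x y z :
    composable (x, y) -> composable (y, z) -> composable (gmul x y, z);
  composable_mulr x y z :
    composable (x, y) -> composable (y, z) -> composable (x, gmul y z);
  gmulA x y z : composable (x, y) -> composable (y, z) ->
    gmul (gmul x y) z = gmul x (gmul y z);
  ginvK x : ginv (ginv x) = x;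
  composableVl x : composable (ginv x, x);
  gmulKV x y : composable (x, y) -> gmul (ginv x) (gmul x y) = y;
  composableVr x : composable (x, ginv x);
  gmulVK x y : composable (y, x) -> gmul (gmul y x) (ginv x) = y
}.

Section groupoid_defs.
Context (G : Type) (g : groupoid G).

Definition rng (x : G) : G := gmul g x (ginv g x).

Definition dom (x : G) : G := gmul g (ginv g x) x.

Definition units : set G := range rng.

Definition rfibre (u : G) : set G := rng @^-1` [set u].

Definition dfibre (u : G) : set G := dom @^-1` [set u].

Definition transitive_groupoid :=
  forall u v, units u -> units v -> exists x, rng x = u /\ dom x = v.

Lemma composableE x y : composable g (x, y) <-> dom x = rng y.
Proof.
split=> [xy|xy]; last first.
  have x_ry : composable g (x, rng y).
    by rewrite -xy; apply: composable_mulr (composableVr g x) (composableVl g x).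
  have ry_y : composable g (rng y, y).
    by apply: composable_mull (composableVr g y) (composableVl g y).
  have ryK : gmul g (rng y) y = y.
    by rewrite -{2}(ginvK g y) (gmulVK (composableVr g y)).
  by have := composable_mulr x_ry ry_y; rewrite ryK.
have xVx := composableVl g x.
have xyyV : composable g (gmul g x y, ginv g y).
  exact: composable_mull xy (composableVr g y).
have xVxy : composable g (ginv g x, gmul g x y) by exact: composable_mulr xVx xy.
by rewrite /rng -{1}(gmulKV xy) (gmulA xVxy xyyV) (gmulVK xy).
Qed.

End groupoid_defs.

(* The relatively open subsets of A; unlike the opens of [subspace A], they    *)
(* are all included in A.                                                      *)
Definition induced (T : topologicalType) (A : set T) : set (set T) :=
  [set U `&` A | U in open].

Section topological_groupoid_defs.
Context (G : topologicalType) (g : groupoid G).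

Definition topological_groupoid :=
  continuous (ginv g) /\
  {within composable g, continuous (fun p : G * G => gmul g p.1 p.2)}.

Definition locally_transitive := topological_groupoid /\
  forall u, units g u -> forall U, induced (dfibre g u) U ->
    induced (units g) (rng g @` U).

Definition open_range_map :=
  forall U, open U -> induced (units g) (rng g @` U).

End topological_groupoid_defs.

Definition borel_sets (T : topologicalType) : set (set T) :=
  <<s [set U : set T | open U] >>.

(* Main.v *)
Require Import Defs.
From HB Require Import structures.
From mathcomp Require Import all_boot.
From mathcomp Require Import all_classical.
From mathcomp Require Import topology measure.

Set Implicit Arguments.
Unset Strict Implicit.
Unset Printing Implicit Defensive.

Local Open Scope classical_set_scope.

(* For a unit e let G_e be its d-fibre. By transitivity the map
   (x, y) |-> x y^-1 is a surjection of G_e * G_e onto G whose fibres are the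
   orbits of the diagonal right action of the isotropy group at e. The new
   topology is the corresponding quotient topology. Being a quotient by a group
   action, the map is open, so second countability and local compactness descend
   from the closed subspace G_e * G_e; as the map is tau-continuous, the new
   topology is finer than tau, hence Hausdorff. Its open sets are countable
   unions of compact sets, which are tau-compact, hence tau-closed: this gives
   the equality of the Borel structures. *)

(** * Groupoid algebra, centred on the quotient x y^-1 *)

Section groupoid_theory.
Context (G : Type) (g : groupoid G).
Implicit Types x y z h u e : G.

Definition gdiv x y := gmul g x (ginv g y).

Lemma rngV x : rng g (ginv g x) = dom g x.
Proof. by rewrite /rng ginvK. Qed.

Lemma domV x : dom g (ginv g x) = rng g x.
Proof. by rewrite /dom ginvK. Qed.

Lemma domM x y : dom g x = rng g y -> dom g (gmul g x y) = dom g y.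
Proof.
move=> /composableE xy; rewrite -(rngV y); apply/composableE.
exact: composable_mull xy (composableVr g y).
Qed.

Lemma rngM x y : dom g x = rng g y -> rng g (gmul g x y) = rng g x.
Proof.
move=> /composableE xy; rewrite -(domV x); apply/esym/composableE.
exact: composable_mulr (composableVl g x) xy.
Qed.

Lemma mulgA x y z : dom g x = rng g y -> dom g y = rng g z ->
  gmul g (gmul g x y) z = gmul g x (gmul g y z).
Proof. by move=> /composableE xy /composableE yz; apply: gmulA. Qed.

Lemma mulKVg x y : dom g x = rng g y -> gmul g (ginv g x) (gmul g x y) = y.
Proof. by move=> /composableE; apply: gmulKV. Qed.

Lemma mulVKg x y : dom g y = rng g x -> gmul g (gmul g y x) (ginv g x) = y.
Proof. by move=> /composableE; apply: gmulVK. Qed.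

Lemma mulgKV x y : dom g x = dom g y -> gmul g (gdiv x y) y = x.
Proof.
by move=> xy; rewrite -{2}(ginvK g y) mulVKg // rngV.
Qed.

Lemma rng_dom x : rng g (dom g x) = dom g x.
Proof. exact: etrans (rngM (domV x)) (rngV x). Qed.

Lemma dom_dom x : dom g (dom g x) = dom g x.
Proof. exact: domM (domV x). Qed.

Lemma unit_rng x : units g (rng g x).
Proof. by exists x. Qed.

Lemma unit_dom x : units g (dom g x).
Proof. by rewrite -rngV; apply: unit_rng. Qed.

Lemma rng_unit u : units g u -> rng g u = u.
Proof. by case=> x _ <-; rewrite -(domV x) rng_dom. Qed.

Lemma dom_unit u : units g u -> dom g u = u.
Proof. by case=> x _ <-; rewrite -(domV x) dom_dom. Qed.

Lemma mulg_dom x : gmul g x (dom g x) = x.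
Proof. by rewrite -{1}(ginvK g x) mulKVg // domV. Qed.

Lemma mul_rngg x : gmul g (rng g x) x = x.
Proof. by rewrite mulgKV. Qed.

Lemma inv_unit u : units g u -> ginv g u = u.
Proof.
move=> uu; rewrite -[LHS]mulg_dom domV (rng_unit uu).
exact: dom_unit.
Qed.

Lemma rng_div x y : dom g x = dom g y -> rng g (gdiv x y) = rng g x.
Proof. by move=> xy; rewrite rngM // rngV. Qed.

Lemma dom_div x y : dom g x = dom g y -> dom g (gdiv x y) = rng g y.
Proof. by move=> xy; rewrite domM ?domV // rngV. Qed.

Lemma divg_dom x : gdiv x (dom g x) = x.
Proof. by rewrite /gdiv inv_unit ?mulg_dom //; apply: unit_dom. Qed.

Lemma inv_uniq x y : dom g x = rng g y -> units g (gmul g x y) ->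
  y = ginv g x.
Proof.
move=> xy uxy; have := mulKVg xy; rewrite -(rng_unit uxy) (rngM xy).
by rewrite -domV mulg_dom.
Qed.

Lemma invdiv x y : dom g x = dom g y -> ginv g (gdiv x y) = gdiv y x.
Proof.
move=> xy; apply/esym/inv_uniq; first by rewrite dom_div // rng_div.
rewrite /gdiv -mulgA ?domV ?rngV // ?mulgKV //; last by rewrite dom_div.
exact: unit_rng.
Qed.

Lemma div_unit_eq x y : dom g x = dom g y -> units g (gdiv x y) -> x = y.
Proof.
move=> xy uxy; rewrite -[LHS](mulgKV xy) -(dom_unit uxy) dom_div //.
by rewrite mul_rngg.
Qed.

Lemma mul_div x y h : dom g x = rng g h -> dom g y = dom g h ->
  gmul g x (gdiv h y) = gdiv (gmul g x h) y.
Proof. by move=> xh yh; rewrite /gdiv mulgA // rngV. Qed.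

(** This makes [gdiv] constant on the orbits of the diagonal right action. *)
Lemma divMM x y h : dom g x = rng g h -> dom g y = rng g h ->
  gdiv (gmul g x h) (gmul g y h) = gdiv x y.
Proof.
move=> xh yh; rewrite -mul_div ?domM //; congr gmul.
apply: inv_uniq; first by rewrite rng_div ?domM.
rewrite mul_div ?domM //; exact: unit_rng.
Qed.

(* The fibres of [gdiv] on pairs with equal domain are the orbits of the
   diagonal right action of the isotropy groups. *)
Lemma div_eq x y x0 y0 : dom g x = dom g y -> dom g x0 = dom g y0 ->
  gdiv x y = gdiv x0 y0 ->
  exists h, [/\ rng g h = dom g x, dom g h = dom g x0,
    gmul g x h = x0 & gmul g y h = y0].
Proof.
move=> xy xy0 eqd; have ryy0 : rng g y = rng g y0.
  by rewrite -(dom_div xy) eqd dom_div.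
(* The condition y h = y0 forces this choice; equality of the two quotients then yields x h = x0. *)
exists (gmul g (ginv g y) y0); split.
- by rewrite rngM ?domV // rngV.
- by rewrite domM ?domV.
- rewrite -mulgA ?domV ?rngV // -/(gdiv x y) eqd mulgKV //.
- by rewrite -{1}(ginvK g y) mulKVg // domV.
Qed.

Lemma mul_div_div x y y' z : dom g x = dom g y -> dom g y' = dom g z ->
  rng g y = rng g y' ->
  gmul g (gdiv x y) (gdiv y' z) = gdiv (gmul g (gdiv x y) y') z.
Proof. by move=> xy yz yy; rewrite mul_div // dom_div. Qed.

Lemma div_mulV x a : rng g x = rng g a ->
  gdiv x (gmul g (ginv g a) x) = a.
Proof.
move=> xa; rewrite -[X in gmul g _ X](ginvK g x) -/(gdiv _ _).
rewrite /gdiv invdiv ?domV // /gdiv ginvK -{1}(ginvK g x).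
by rewrite mulKVg // domV.
Qed.

(** Transitivity provides [x] with domain [e] and the range of [a]; then y = a^-1 x completes the
    pair. *)
Lemma transitive_div e a : transitive_groupoid g -> units g e ->
  exists x y, [/\ dom g x = e, dom g y = e & gdiv x y = a].
Proof.
move=> tg ue; have [x [xa xe]] := tg _ _ (unit_rng a) ue.
exists x, (gmul g (ginv g a) x); rewrite domM ?domV //; split => //.
exact: div_mulV.
Qed.

End groupoid_theory.

(** * General topology: relatively open sets, open sets as countable unions of compacts *)

Lemma inducedP (T : topologicalType) (D U : set T) :
  induced D U <->
  U `<=` D /\ forall x, U x -> \forall y \near within D (nbhs x), U y.
Proof.
split=> [[V oV <-]|[UD Unear]].
  split=> [x []//|x [Vx _]]; apply: filterS (open_nbhs_nbhs (conj oV Vx)).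
  by move=> y Vy Dy.
(* This is the largest open set whose trace on [D] lies in [U]. *)
exists (interior [set y | D y -> U y]); first exact: open_interior.
apply/seteqP; split=> [x [/interior_subset xU Dx]|x Ux]; first exact: xU.
by split; [exact: Unear|exact: UD].
Qed.

(** The compact closures of basic sets that lie inside [O] are countably many; regularity of compact
    neighbourhoods shows that they cover [O]. *)
Lemma open_countable_compact (T : topologicalType) (O : set T) :
  @second_countable T -> locally_compact [set: T] -> hausdorff_space T ->
  open O -> exists2 K : nat -> set T,
    forall n, compact (K n) & O = \bigcup_n K n.
Proof.
move=> [B cB [Bo Bb]] lcT hT oO.
pose C := [set closure b | b in [set b | [/\ B b, compact (closure b) &
  closure b `<=` O]]].
have cC : countable C.
  apply: sub_countable (card_image_le _ _) _.
  by apply: sub_countable cB; apply: subset_card_le => b [].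
have OC : O = \bigcup_(K in C) K.
  apply/seteqP; split=> [x Ox|x [_ [b [_ _ bO] <-]] /bO //].
  have [V] := lcT x I; rewrite withinET => Vx [cV clV].
  have [W Wx WO] := compact_regular hT cV Vx
    (filterI Vx (open_nbhs_nbhs (conj oO Ox))).
  have [b [Bb' bx] bW] := Bb x _ Wx.
  have clb : closure b `<=` V `&` O by apply: subset_trans WO; apply: closureS.
  exists (closure b); last exact: subset_closure.
  exists b => //; split=> //; last by move=> y /clb[].
  apply: subclosed_compact cV _; first exact: closed_closure.
  by move=> y /clb[].
(* If the family is empty then so is [O], and a constant sequence of empty sets serves; otherwise a
   surjection from the naturals enumerates the family. *)
have /pfcard_geP[C0|[f]] := cC.
  exists (fun=> set0) => [_|]; first exact: compact0.
  by rewrite OC C0 bigcup_set0 bigcup0.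
exists (fun n => f n).
  by move=> n; have [b [_ ? _] <-] : C (f n) by exact: funS.
rewrite OC; apply/seteqP; split=> [x [K CK Kx]|x [n _ fx]].
  by have [n _ fn] := @surj _ _ _ _ f K CK; exists n => //; rewrite fn.
by exists (f n) => //; exact: funS.
Qed.

(* The phantom argument [g] keys the topology declared on this copy of [G]. *)
Definition fibred (G : topologicalType) (g : groupoid G) : Type := G.

(** * The quotient topology on a copy of [G] *)

Section fibred_topology.
Context (G : topologicalType) (g : groupoid G).
Local Notation fibred := (fibred g).

Definition dfibre2 (e : G) : set (G * G) := dfibre g e `*` dfibre g e.

HB.instance Definition _ := Choice.on fibred.

Definition fdiv (p : G * G) : fibred := gdiv g p.1 p.2.

(* The quotient topology of the maps (x, y) |-> x y^-1 on G_e * G_e, for all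
   units e at once. *)
Definition fibred_open : set_system fibred :=
  [set O | forall e p, dfibre2 e p -> O (fdiv p) ->
    \forall q \near within (dfibre2 e) (nbhs p), O (fdiv q)].

Let fibred_openT : fibred_open setT.
Proof. by move=> e p _ _; apply: filterE. Qed.

Let fibred_openI : setI_closed fibred_open.
Proof.
move=> A B oA oB e p ep [Ap Bp].
by apply: filterI; [exact: oA|exact: oB].
Qed.

Let fibred_open_bigcup (I : Type) (f : I -> set fibred) :
  (forall i, fibred_open (f i)) -> fibred_open (\bigcup_i f i).
Proof.
move=> of_ e p ep [i _ fp]; have := of_ i e p ep fp.
by apply: filterS => q fq; exists i.
Qed.

HB.instance Definition _ := isOpenTopological.Build fibred
  fibred_openT fibred_openI fibred_open_bigcup.

Lemma open_fibredE : @open fibred = fibred_open. Proof. by []. Qed.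

Lemma fdiv_cvg e p : dfibre2 e p ->
  fdiv @ within (dfibre2 e) (nbhs p) --> fdiv p.
Proof.
move=> ep W; rewrite nbhsE => -[O [oO Op] OW].
by apply: filterS (oO e p ep Op) => q /OW.
Qed.

(** * Continuity of the operations and openness of the quotient map *)

Section topological.
Hypothesis tg : topological_groupoid g.

(** Filter form of continuity on G^(2): composability is only asked eventually, so that the lemma
    applies along [within] filters. *)
Lemma mulg_cvg (T : Type) (F : set_system T) (a b : T -> G) x y :
  Filter F -> dom g x = rng g y ->
  (\forall t \near F, dom g (a t) = rng g (b t)) ->
  a @ F --> x -> b @ F --> y ->
  (fun t => gmul g (a t) (b t)) @ F --> gmul g x y.
Proof.
move=> FF xy ab ax bY; have [_ /subspace_continuousP cm] := tg.
have /cm cmxy : composable g (x, y) by apply/composableE.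
apply: (@cvg_comp _ _ _ (fun t => (a t, b t)) _ _ _ _ _ cmxy).
have abxy := cvg_pair ax bY.
move=> W /= /abxy; rewrite /= => Wab.
near=> t; have : composable g (a t, b t) by apply/composableE; near: t.
by near: t.
Unshelve. all: by end_near. Qed.

Lemma invg_cvg (T : Type) (F : set_system T) (a : T -> G) x :
  Filter F -> a @ F --> x -> (fun t => ginv g (a t)) @ F --> ginv g x.
Proof. by move=> FF ax; apply: (cvg_comp _ _ ax); apply: tg.1. Qed.

Lemma gdiv_cvg (T : Type) (F : set_system T) (a b : T -> G) x y :
  Filter F -> dom g x = dom g y ->
  (\forall t \near F, dom g (a t) = dom g (b t)) ->
  a @ F --> x -> b @ F --> y ->
  (fun t => gdiv g (a t) (b t)) @ F --> gdiv g x y.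
Proof.
move=> FF xy ab ax bY; apply: mulg_cvg => //; last exact: invg_cvg.
  by rewrite rngV.
by apply: filterS ab => t; rewrite rngV.
Qed.

Lemma rng_continuous : continuous (rng g).
Proof.
by move=> x; apply: gdiv_cvg => //; exact: filterE.
Qed.

Lemma dom_continuous : continuous (dom g).
Proof.
move=> x; have -> : dom g = rng g \o ginv g.
  by apply/funext => y /=; rewrite rngV.
by apply: continuous_comp; [exact: tg.1|exact: rng_continuous].
Qed.

Lemma fibred_openW : @open G `<=` @open fibred.
Proof.
move=> O oO; rewrite open_fibredE => e p [p1 p2] Op.
have : (fun q => gdiv g q.1 q.2) @ within (dfibre2 e) (nbhs p) -->
  gdiv g p.1 p.2.
  apply: gdiv_cvg; rewrite ?p1 ?p2//.
  - by apply: filterS (withinT _ _) => q [-> ->].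
  - by apply: cvg_within_filter; exact: cvg_fst.
  - by apply: cvg_within_filter; exact: cvg_snd.
by apply; apply: open_nbhs_nbhs.
Qed.

Lemma fibred_id_continuous : continuous (fun x : fibred => x : G).
Proof. by apply/continuousP => A /fibred_openW. Qed.

(* If [gdiv] sends (x, y) to a point of the image of [P], then a translate
   (x h, y h) lies in [P], hence so does (x' h, y' h) for (x', y') close to
   (x, y) in the same fibre. *)
Lemma fdiv_open e (P : set (G * G)) : open P ->
  open [set fdiv p | p in P `&` dfibre2 e].
Proof.
move=> oP; rewrite open_fibredE => e' [x y] [/= xe ye].
move=> [[x0 y0] [/= Pp [/= x0e y0e]]]; rewrite /fdiv /= => eqd.
have [||h [hx hx0 xh yh]] := div_eq _ _ (esym eqd); rewrite ?xe ?x0e//.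
rewrite xe in hx; rewrite x0e in hx0.
have : (fun q => (gmul g q.1 h, gmul g q.2 h)) @
    within (dfibre2 e') (nbhs (x, y)) --> (x0, y0).
  rewrite -xh -yh; apply: cvg_pair; apply: mulg_cvg => //.
  - by rewrite xe.
  - by apply: filterS (withinT _ _) => q [-> _].
  - by apply: cvg_within_filter; exact: cvg_fst.
  - exact: cvg_cst.
  - by rewrite ye.
  - by apply: filterS (withinT _ _) => q [_ ->].
  - by apply: cvg_within_filter; exact: cvg_snd.
  - exact: cvg_cst.
move=> /(_ P (open_nbhs_nbhs (conj oP Pp))) /= Ph.
near=> q.
have [q1 q2] : dfibre2 e' q by near: q; exact: withinT.
have Pq : P (gmul g q.1 h, gmul g q.2 h) by near: q; exact: Ph.
exists (gmul g q.1 h, gmul g q.2 h); last by rewrite /fdiv/= divMM// ?q1 ?q2.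
by split => //; split; rewrite /dfibre/= domM// ?q1 ?q2.
Unshelve. all: by end_near. Qed.

Lemma nbhs_fdiv e p (P : set (G * G)) : dfibre2 e p -> nbhs p P ->
  nbhs (fdiv p) [set fdiv q | q in P `&` dfibre2 e].
Proof.
move=> ep /nbhs_interior/nbhs_singleton Pp.
have oP := @fdiv_open e _ (open_interior P).
have /(conj oP)/open_nbhs_nbhs : [set fdiv q | q in P° `&` dfibre2 e] (fdiv p).
  by exists p.
by apply: filterS; apply: image_subset; apply: setSI; exact: interior_subset.
Qed.

End topological.
End fibred_topology.

(** * Continuity of the groupoid operations for the quotient topology *)

Section fibred_groupoid.
Context (G : topologicalType) (g : groupoid G) (tg : topological_groupoid g).
Local Notation G' := (fibred g).

(** Every [a] has a canonical lift over its own unit [dom g a]; it is available at each point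
    because the topology involves all units at once. *)
Lemma fdiv_dom (a : G) : fdiv g (a, dom g a) = a.
Proof. exact: divg_dom. Qed.

Lemma dfibre2_dom (a : G) : dfibre2 g (dom g a) (a, dom g a).
Proof. by split; rewrite /dfibre/= ?dom_dom. Qed.

Lemma inv_fdiv e x y : dfibre2 g e (x, y) ->
  ginv g (fdiv g (x, y)) = fdiv g (y, x).
Proof. by case=> /= xe ye; rewrite /fdiv invdiv //= xe ye. Qed.

Lemma fdiv_cvgX e x y (W : set G') : dfibre2 g e (x, y) ->
  nbhs (fdiv g (x, y)) W -> exists A B, [/\ nbhs x A, nbhs y B &
    forall p, (A `*` B) p -> dfibre2 g e p -> W (fdiv g p)].
Proof.
move=> exy /(fdiv_cvg exy) [[A B] /= [Ax By] AB].
by exists A, B; split => // p /AB.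
Qed.

Lemma nbhs_fdivX e x y (A B : set G) : dfibre2 g e (x, y) ->
  nbhs x A -> nbhs y B ->
  nbhs (fdiv g (x, y)) [set fdiv g p | p in (A `*` B) `&` dfibre2 g e].
Proof. by move=> exy Ax By; apply: nbhs_fdiv => //; exists (A, B). Qed.

(** Inversion lifts to the exchange of the two coordinates of a pair. *)
Lemma ginv_fibred_continuous : continuous (ginv g : G' -> G').
Proof.
move=> a W; have ea := dfibre2_dom a; rewrite -{1}(fdiv_dom a) (inv_fdiv ea).
have ea' : dfibre2 g (dom g a) (dom g a, a) by case: ea.
move=> /(fdiv_cvgX ea') [A [B [Ae Ba AB]]].
have := nbhs_fdivX ea Ba Ae; rewrite fdiv_dom.
apply: filterS => _ [[x y] [[/= Bx Ay] exy] <-] /=.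
by rewrite (inv_fdiv exy); apply: AB => //; case: exy.
Qed.

(** The map (x, y, y') |-> x y^-1 y' is continuous at (a, e, e), where its value is a.
    Neighbourhoods are given as boxes so that [fdiv] can push them forward. *)
Lemma nbhs_gdiv_mul (a : G) (A : set G) (e := dom g a) : nbhs a A ->
  exists X Y Y', [/\ nbhs a X, nbhs e Y, nbhs e Y' &
    forall x y y', (X `*` Y) (x, y) -> Y' y' -> dfibre2 g e (x, y) ->
      dom g y' = e -> rng g y = rng g y' -> A (gmul g (gdiv g x y) y')].
Proof.
move=> Aa; have ee : dom g e = e by rewrite dom_dom.
pose D := [set t : (G * G) * G | [/\ dfibre2 g e t.1, dom g t.2 = e &
  rng g t.1.2 = rng g t.2]].
have : (fun t => gmul g (gdiv g t.1.1 t.1.2) t.2) @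
    within D (nbhs ((a, e), e)) --> gmul g (gdiv g a e) e.
  apply: mulg_cvg => //.
  - by rewrite divg_dom rng_dom.
  - near=> t; have [[t1 t2] _ t3] : D t by near: t; exact: withinT.
    by rewrite -t3 dom_div // t1 t2.
  - apply: gdiv_cvg => //.
    + near=> t; have [[t1 t2] _ _] : D t by near: t; exact: withinT.
      by rewrite t1 t2.
    + apply: cvg_within_filter.
      by apply: (@cvg_comp _ _ _ fst fst _ (nbhs (a, e))); exact: cvg_fst.
    + apply: cvg_within_filter.
      apply: (@cvg_comp _ _ _ fst snd _ (nbhs (a, e))); first exact: cvg_fst.
      exact: cvg_snd.
  - by apply: cvg_within_filter; exact: cvg_snd.
rewrite divg_dom mulg_dom => /(_ A Aa).
move=> [[P Y'] /= [[[X Y] /= [Xa Ye] XY] Y'e] PY'].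
exists X, Y, Y'; split => // x y y' XYxy Yy' xy ye yy.
by apply: (PY' ((x, y), y')); split => //; exact: XY.
Unshelve. all: by end_near. Qed.

(* Write a' = x y^-1 and b' = y' z^-1 with x, y, y', z in the same fibre: then
   a' b' = (x y^-1 y') z^-1, and x y^-1 y' is close to a when x is close to a
   and y, y' are close to the unit d(a). *)
Lemma fibred_topological_groupoid : @topological_groupoid G' g.
Proof.
split; first exact: ginv_fibred_continuous.
apply/subspace_continuousP => -[a b] /composableE/= ab W.
have ea := dfibre2_dom a.
set e := dom g a in ab ea.
have eb : dfibre2 g e (a, ginv g b) by split => //=; rewrite /dfibre/= domV.
have eb' : dfibre2 g e (e, ginv g b).
  by split; rewrite /dfibre/= ?domV // dom_dom.
have bE : fdiv g (e, ginv g b) = b by rewrite /fdiv/= /gdiv ginvK ab mul_rngg.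
have abE : gmul g a b = fdiv g (a, ginv g b) by rewrite /fdiv/= /gdiv ginvK.
rewrite /from_subspace /= abE => /(fdiv_cvgX eb) [A [B [Aa Bb AB]]].
have [X [Y [Y' [Xa Ye Y'e XYY']]]] := nbhs_gdiv_mul Aa.
have := nbhs_fdivX ea Xa Ye; rewrite fdiv_dom => nbhs_a.
have := nbhs_fdivX eb' Y'e Bb; rewrite bE => nbhs_b.
exists ([set fdiv g p | p in (X `*` Y) `&` dfibre2 g e],
  [set fdiv g p | p in (Y' `*` B) `&` dfibre2 g e]) => //=.
move=> [a' b'] [/= [[x y] [XYxy [/= xe ye]] <-]].
move=> [[y' z] [[/= Y'y Bz] [/= ye' ze]] <-] /composableE.
have xy : dom g x = dom g y by rewrite xe ye.
have yz : dom g y' = dom g z by rewrite ye' ze.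
rewrite /fdiv/= dom_div // rng_div // => yy'.
rewrite mul_div_div //.
apply: (AB (gmul g (gdiv g x y) y', z)); split => //=; first exact: XYY'.
by rewrite /dfibre/= domM // dom_div.
Qed.

(** * Fibres, the range map and comparison of the two topologies *)

(** The unit r(z) lifts to (z, z), so a point near it is some x y^-1 with x near z; when that point
    is a unit, x = y and the point is r(x). *)
Lemma nbhs_rng (U : set G) (z : G) : U z ->
  (\forall t \near within (dfibre g (dom g z)) (nbhs z), U t) ->
  \forall u \near within (units g) (nbhs (rng g z : G')), (rng g @` U) u.
Proof.
move=> Uz Unear; have ez : dfibre2 g (dom g z) (z, z) by [].
have /(nbhs_fdiv tg ez) : nbhs (z, z) [set p | dfibre g (dom g z) p.1 -> U p.1].
  exists ([set t | dfibre g (dom g z) t -> U t], setT); last by move=> p [].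
  by split => //; exact: filterT.
apply: filterS => _ [[x y] /= [Ux [/= xe ye]] <-] uxy.
have xy : x = y by apply: (div_unit_eq _ uxy); rewrite xe ye.
by exists x; [exact: Ux|rewrite xy].
Qed.

(** On this fibre the lift [(t, dom g t)] has constant second coordinate, hence depends continuously
    on [t]. *)
Lemma nbhs_dfibre (W : set G) (z : G) : nbhs (z : G') W ->
  \forall t \near within (dfibre g (dom g z)) (nbhs z), W t.
Proof.
have ez := dfibre2_dom z; rewrite -{1}(fdiv_dom z).
move=> /(fdiv_cvgX ez) [A [B [Az Be AB]]].
apply: filterS Az => t At te; rewrite -[t]fdiv_dom te; apply: AB => //.
- by split => //; exact: nbhs_singleton.
- by case: ez.
Qed.

(** Here [t] is lifted to [(rng g t, ginv g t)]: the first coordinate is constant on the fibre, the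
    second is continuous. *)
Lemma nbhs_rfibre (W : set G) (z : G) : nbhs (z : G') W ->
  \forall t \near within (rfibre g (rng g z)) (nbhs z), W t.
Proof.
have fdiv_rng t : fdiv g (rng g t, ginv g t) = t.
  by rewrite /fdiv/= /gdiv ginvK mul_rngg.
have ez t : rng g t = rng g z -> dfibre2 g (rng g z) (rng g z, ginv g t).
  by split; rewrite /dfibre/= ?domV // dom_unit //; exact: unit_rng.
rewrite -{1}(fdiv_rng z) => /(fdiv_cvgX (ez z erefl)) [A [B [Ae Bz AB]]].
have zB : nbhs z (ginv g @^-1` B) by exact: tg.1.
apply: filterS zB => t Bt tz; rewrite -[t]fdiv_rng tz.
apply: AB; last exact: ez.
by split => //; exact: nbhs_singleton.
Qed.

(** As the new topology is finer, only one inclusion is at stake, and it is checked on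
    neighbourhoods. *)
Lemma induced_fibred (D : set G) :
  (forall z (W : set G), D z -> nbhs (z : G') W ->
    \forall t \near within D (nbhs z), W t) ->
  @induced G D = @induced G' D.
Proof.
move=> DG'; apply/seteqP; split=> [_ [O oO <-]|_ [O oO <-]].
  by exists O => //; exact: fibred_openW.
apply/inducedP; split=> [x []//|z [Oz Dz]].
by apply: filterI; [exact: DG' (open_nbhs_nbhs (conj oO Oz))|exact: withinT].
Qed.

Lemma induced_rfibre u : @induced G (rfibre g u) = @induced G' (rfibre g u).
Proof. by apply: induced_fibred => z W <-; exact: nbhs_rfibre. Qed.

Lemma induced_dfibre u : @induced G (dfibre g u) = @induced G' (dfibre g u).
Proof. by apply: induced_fibred => z W <-; exact: nbhs_dfibre. Qed.

Lemma fibred_locally_transitive : @locally_transitive G' g.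
Proof.
split=> [|u uu U]; first exact: fibred_topological_groupoid.
(* Both topologies agree on the fibre, so [U] is relatively open for tau, which is what [nbhs_rng]
   takes. *)
rewrite -induced_dfibre => /inducedP[Uu Unear].
apply/(@inducedP G'); split=> [_ [z _ <-]|_ [z Uz <-]]; first exact: unit_rng.
by apply: nbhs_rng => //; rewrite (Uu _ Uz); exact: Unear.
Qed.

Lemma fibred_open_range_map : @open_range_map G' g.
Proof.
move=> O oO; apply/(@inducedP G'); split=> [_ [z _ <-]|_ [z Oz <-]].
  exact: unit_rng.
by apply: nbhs_rng => //; exact: nbhs_dfibre (open_nbhs_nbhs (conj oO Oz)).
Qed.

(* For a' close to a, openness of r on G_d(a) yields x close to a in G_d(a)
   with r(x) = r(a'); then a' = x (a'^-1 x)^-1. *)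
Lemma open_fibred_id : locally_transitive g -> @open G = @open G'.
Proof.
move=> [_ rng_open]; apply/seteqP; split=> [O|O oO]; first exact: fibred_openW.
rewrite openE => a Oa; have ea := dfibre2_dom a.
have : nbhs (fdiv g (a, dom g a)) O.
  by rewrite fdiv_dom; exact: open_nbhs_nbhs.
move=> /(fdiv_cvgX ea) [A [B [Aa Be AB]]].
pose D := [set t : G * G | rng g t.1 = rng g t.2].
have : (fun t => gmul g (ginv g t.1) t.2) @ within D (nbhs (a, a)) -->
    gmul g (ginv g a) a.
  apply: mulg_cvg => //.
  - by rewrite domV.
  - near=> t; have tD : D t by near: t; exact: withinT.
    by rewrite domV.
  - by apply: invg_cvg => //; apply: cvg_within_filter; exact: cvg_fst.
  - by apply: cvg_within_filter; exact: cvg_snd.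
move=> /(_ B Be) [[P Q] /= [Pa Qa] PQ].
(* [A] will control the first coordinate [x] of the lift and [Q], through [PQ], the second
   coordinate t^-1 x. *)
have [|V oV VE] := rng_open _ (unit_dom g a)
    ((A `&` Q)° `&` dfibre g (dom g a)).
  by exists (A `&` Q)°%classic => //; exact: open_interior.
have Va : V (rng g a).
  suff [] : (V `&` units g) (rng g a) by [].
  by rewrite VE; exists a => //; split => //; exact: filterI.
have nV := @rng_continuous _ _ tg a _ (open_nbhs_nbhs (conj oV Va)).
apply: filterS (filterI Pa nV) => t [Pt Vt].
have : (V `&` units g) (rng g t) by split => //; exact: unit_rng.
rewrite VE => -[x [/interior_subset [Ax Qx] xe] xt].
have -> : t = fdiv g (x, gmul g (ginv g t) x) by rewrite /fdiv/= div_mulV.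
apply: AB; split => //=; first exact: (PQ (t, x)).
by rewrite /dfibre/= domM // domV.
Unshelve. all: by end_near. Qed.

(** * Separation, countability, local compactness and Borel sets *)

Lemma fibred_hausdorff : hausdorff_space G -> hausdorff_space G'.
Proof.
move=> hG p q pq; apply: hG => A B Ap Bq; apply: pq.
- exact: fibred_id_continuous Ap.
- exact: fibred_id_continuous Bq.
Qed.

(** By transitivity every point lifts to a pair over one fixed unit [e], so the images of the
    countably many basic boxes over [e] form a base. *)
Lemma fibred_second_countable : transitive_groupoid g ->
  @second_countable G -> @second_countable G'.
Proof.
move=> trg [B cB [Bo Bb]].
have [[e ue]|units0] := pselect (exists u, units g u); last first.
  (* Without units [G] is empty, and the empty family is a base. *)
  exists set0; first exact: countable0.
  by split=> // x; case: units0; exists (rng g x); exact: unit_rng.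
pose img := fun UV => [set fdiv g p | p in (UV.1 `*` UV.2) `&` dfibre2 g e].
exists [set img UV | UV in B `*` B].
  by apply: sub_countable (card_image_le _ _) _; exact: countableX.
split=> [_ [[U V] [/= /Bo oU /Bo oV] <-]|a W].
  apply: fdiv_open => //; rewrite openE => -[x y] [/= Ux Vy].
  by exists (U, V) => //; split; exact: open_nbhs_nbhs.
have [x [y [xe ye <-]]] := transitive_div a trg ue.
move=> /(@fdiv_cvgX e x y) [//|C [D [Cx Dy CD]]].
have [U [BU Ux] UC] := Bb x C Cx; have [V [BV Vy] VD] := Bb y D Dy.
exists (img (U, V)); first by split; [exists (U, V)|exists (x, y)].
move=> _ [p [[Up Vp] pe] <-]; apply: CD => //.
by split; [exact: UC|exact: VD].
Qed.

(** A box of compact neighbourhoods around the lift [(a, dom g a)], cut by the closed fibre, has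
    compact image, which is a neighbourhood because [fdiv] is open. *)
Lemma fibred_locally_compact : hausdorff_space G ->
  locally_compact [set: G] -> @locally_compact G' setT.
Proof.
move=> hG lcG a _; rewrite withinET; have ea := dfibre2_dom a.
have [A] := lcG a I; rewrite withinET => Aa [cA _].
have [B] := lcG (dom g a) I; rewrite withinET => Be [cB _].
have := nbhs_fdivX ea Aa Be; rewrite fdiv_dom => aAB.
exists [set fdiv g p | p in (A `*` B) `&` dfibre2 g (dom g a)] => //.
have cd : closed (dfibre g (dom g a)).
  apply: preimage_closed; first by move=> x _; exact: dom_continuous.
  exact: accessible_closed_set1 (hausdorff_accessible hG) _.
suff cAB : compact [set fdiv g p | p in (A `*` B) `&` dfibre2 g (dom g a)].
  by split => //; apply: compact_closed => //; exact: fibred_hausdorff.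
apply: continuous_compact; last first.
  have -> : (A `*` B) `&` dfibre2 g (dom g a) =
      (A `&` dfibre g (dom g a)) `*` (B `&` dfibre g (dom g a)).
    by apply/seteqP; split=> -[x y] [] [? ?] [].
  by apply: compact_setX; exact: compact_closedI.
apply: (@continuous_subspaceW _ _ _ (dfibre2 g (dom g a))).
  exact: subIsetr.
by apply/subspace_continuousP => p pe; exact: fdiv_cvg.
Qed.

Lemma borel_fibred : hausdorff_space G -> locally_compact [set: G] ->
  transitive_groupoid g -> @second_countable G ->
  @borel_sets G = @borel_sets G'.
Proof.
move=> hG lcG trg scG; apply/seteqP; split.
  by apply: sub_sigma_algebra2; exact: fibred_openW.
apply: smallest_sub; first exact: smallest_sigma_algebra.
move=> O oO; have [K cK ->] := open_countable_compact
  (fibred_second_countable trg scG) (fibred_locally_compact hG lcG)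
  (fibred_hausdorff hG) oO.
apply: sigma_algebra_bigcup => n.
have : @closed G (K n).
  apply: compact_closed => //; rewrite -[K n]image_id.
  apply: (@continuous_compact G' G) => //.
  exact/continuous_subspaceT/fibred_id_continuous.
rewrite -openC => /sub_sigma_algebra/(sigma_algebraCD (D := setT)).
by rewrite setTD setCK.
Qed.

End fibred_groupoid.

Theorem theorem1 (G : topologicalType) (g : groupoid G)
    (G_transitive : transitive_groupoid g)
    (G_second_countable : @second_countable G)
    (G_locally_compact : locally_compact [set: G])
    (G_hausdorff : hausdorff_space G)
    (G_topological : topological_groupoid g) :
  exists tau' : Topological G,
    let G' : topologicalType := Topological.Pack tau' in
    [/\ @locally_transitive G' g /\ @open_range_map G' g,
        (@open G `<=` @open G') /\
          (@locally_transitive G g -> @open G = @open G'),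
        forall u, units g u ->
          @induced G (rfibre g u) = @induced G' (rfibre g u) /\
          @induced G (dfibre g u) = @induced G' (dfibre g u),
        [/\ @second_countable G', @locally_compact G' setT &
          @hausdorff_space G'] &
        @borel_sets G = @borel_sets G'].
Proof.
(* [fibred g] unfolds to [G], so its structure is a topology on [G] itself. *)
exists (Topological.class (fibred g)); split.
- split; first exact: fibred_locally_transitive.
  exact: fibred_open_range_map.
- by split; [exact: fibred_openW|exact: open_fibred_id].
- by move=> u _; split; [exact: induced_rfibre|exact: induced_dfibre].
- split; first exact: fibred_second_countable.
    exact: fibred_locally_compact.
  exact: fibred_hausdorff.
- exact: borel_fibred.
Qed.
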